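(* Let $d$ be a positive integer and let $f\colon\mathbb{F}_2^{d+1}\to\mathbb{F}_2$ be the function of algebraic degree $d$ given by $f(x_1,\dotsc,x_{d+1}) = x_1 \oplus x_2 x_3\dotsm x_d (x_{d+1} \oplus 1)$ (for $d=1$ the product $x_2\dotsm x_d$ is empty, i.e. equal to $1$). For $n>d$ let $\iota(n)$ be the number of elements of $\mathbb{F}_2^n$ that are not in the image of the map $F\colon\mathbb{F}_2^n\to\mathbb{F}_2^n$ induced by $f$. Then, for every $n>d$, $$\iota(n)=\begin{cases} d\cdot 2^{\frac{n}{d}-1} & \text{if } d\mid n,\\ 0 & \text{otherwise.}\end{cases}$$
   Context: For a Boolean function $f\colon\mathbb{F}_2^k\to\mathbb{F}_2$ and $n\geq k$, the induced map $F\colon\mathbb{F}_2^n\to\mathbb{F}_2^n$ is $$F(x_1,\dotsc,x_n)=\big(f(x_1,x_2,\dotsc,x_k),f(x_2,x_3,\dotsc,x_{k+1}),\dotsc,f(x_n,x_1,\dotsc,x_{k-1})\big),$$ with indices cyclic modulo $n$. Here $k=d+1$. *)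

(* Defs.v *)
From mathcomp Require Import all_boot all_algebra.

Set Implicit Arguments.
Unset Strict Implicit.
Unset Printing Implicit Defensive.

Import GRing.Theory.
Local Open Scope ring_scope.

(* [a S] is the coefficient of the monomial [\prod_(i in S) x_i]. *)
Definition is_anf (k : nat) (f : 'rV['F_2]_k -> 'F_2)
    (a : {set 'I_k} -> 'F_2) : Prop :=
  forall x : 'rV['F_2]_k,
    f x = \sum_(S : {set 'I_k}) a S * \prod_(i in S) x ord0 i.

(* The algebraic normal form of [f] exists and is unique, so the existential
   singles it out.  The zero function gets degree 0 here. *)
Definition has_algebraic_degree (k : nat) (f : 'rV['F_2]_k -> 'F_2)
    (m : nat) : Prop :=
  exists a : {set 'I_k} -> 'F_2,
    is_anf f a /\ m = (\max_(S : {set 'I_k} | a S != 0%R) #|S|)%N.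

Definition cyclic_shift (n : nat) (i : 'I_n) (j : nat) : 'I_n :=
  Ordinal (ltn_pmod (i + j) (leq_ltn_trans (leq0n i) (ltn_ord i))).

(* Coordinates are numbered from 0, so coordinate [i] of the image is
   f (x_i, x_{i+1}, ..., x_{i+k-1}), indices modulo n. *)
Definition induced_map (k : nat) (f : 'rV['F_2]_k -> 'F_2) (n : nat)
    (x : 'rV['F_2]_n) : 'rV['F_2]_n :=
  \row_(i < n) f (\row_(j < k) x ord0 (cyclic_shift i j)).

(* With 0-based coordinates, the factors x_2, ..., x_d are those of index
   1, ..., d - 1, and x_{d+1} has index d = ord_max. *)
Definition rule (d : nat) (x : 'rV['F_2]_d.+1) : 'F_2 :=
  x ord0 ord0
  + (\prod_(i < d.+1 | (0 < i < d)%N) x ord0 i) * (x ord0 ord_max + 1).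

Definition num_not_in_image (k : nat) (f : 'rV['F_2]_k -> 'F_2)
    (n : nat) : nat :=
  #|[set y : 'rV['F_2]_n | y \notin codom (@induced_map k f n)]|.

(* Main.v *)
(** Read a cyclic word [x] from right to left and record at each position the
    number of consecutive ones starting there, capped at [d].  Since [F] flips
    [x_i] exactly when this number is [d - 1] at position [i + 1], the record
    can be computed from [y = F x] alone by an automaton with states
    [0, ..., d], and [y] is in the image of [F] iff the transformation of the
    states induced by [y] has a fixed point.  A letter 1 rotates
    [0, ..., d - 1] and fixes [d]; a letter 0 swaps [d - 1] and [d] up to that
    rotation and merges all other states with [d].  So the trajectories of [e]
    and [d] merge unless all zeros of [y] lie in one residue class determined
    by [e], and there is no fixed point iff [d] divides [n], all zeros of [y]
    lie in one class modulo [d] and their number is odd.  There are [d] classes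
    of [n / d] positions, each with [2 ^ (n / d - 1)] odd subsets. *)

Require Import Defs.
From mathcomp Require Import all_boot all_algebra.
From mathcomp Require Import zify.

Set Implicit Arguments.
Unset Strict Implicit.
Unset Printing Implicit Defensive.

Import GRing.Theory.

(** * Trajectories and fixed points of the automaton *)

(* [q] is the capped run of ones after the position whose output letter is [b]. *)
Definition step (d : nat) (b : bool) (q : nat) : nat :=
  if b (+) (q == d.-1) then minn q.+1 d else 0.

(* Every zero is read in a state where the trajectory started at [e] is at
   [d - 1] or has been exchanged with the one started at [d]. *)
Definition aligned (d e : nat) : seq bool -> bool :=
  fix aux w := if w is b :: v then aux v && (b || (d %| e + (size v).+1)) else true.

Lemma step_le d b q : step d b q <= d.
Proof. by rewrite /step; case: ifP => // _; apply: geq_minr. Qed.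

Lemma foldr_step_le d q w : q <= d -> foldr (step d) q w <= d.
Proof. by case: w => //= b w _; apply: step_le. Qed.

Lemma modnS_dvdn d m : 0 < d ->
  (m.+1 %% d = if d %| m.+1 then 0 else (m %% d).+1) /\
  ((m %% d == d.-1) = (d %| m.+1)).
Proof.
move=> d_gt0; split; first exact: modnS.
rewrite /dvdn -add1n -modnDmr add1n; have := ltn_pmod m d_gt0.
rewrite leq_eqVlt => /orP[/eqP E | lt_md]; first by rewrite E modnn; lia.
by rewrite (modn_small lt_md); lia.
Qed.

(** Reading from the right, one trajectory stays at [d] and the other rotates through the residues.
    A 1 keeps these roles, a 0 met with the rotating one at [d - 1] exchanges them, and any other 0
    sends both to 0, after which they agree. *)
Lemma foldr_step_pair d e w : e < d ->
  if aligned d e w then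
    let e' := (e + size w) %% d in
    if odd (count negb w) then foldr (step d) e w = d /\ foldr (step d) d w = e'
    else foldr (step d) e w = e' /\ foldr (step d) d w = d
  else foldr (step d) e w = foldr (step d) d w.
Proof.
move=> lt_ed; have d_gt0 : 0 < d by lia.
elim: w => [|b v] /=; first by rewrite addn0 modn_small.
case: (aligned d e v) => /=; last by move=> ->.
rewrite !addnS; have [E1 E2] := modnS_dvdn (e + size v) d_gt0.
have := ltn_pmod (e + size v) d_gt0; have dd : (d == d.-1) = false by lia.
rewrite E1 -E2 oddD; move: (_ %% d) {E1 E2} => r lt_rd.
by case: (odd _) => -[-> ->]; rewrite /step dd; case: b => /=;
  case: eqP => //= ?; lia.
Qed.

(** An odd count provides a zero, and the first zero already determines the starting state modulo
    [d]. *)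
Lemma aligned_inj d e1 e2 w : e1 < d -> e2 < d -> odd (count negb w) ->
  aligned d e1 w -> aligned d e2 w -> e1 = e2.
Proof.
move=> lt1 lt2; elim: w => //= b v IHv + /andP[a1 z1] /andP[a2 z2].
case: b z1 z2 => /= z1 z2; first by move/IHv; apply.
move=> _; have /eqP : e1 = e2 %[mod d].
  apply/eqP; rewrite -(eqn_modDr (size v).+1).
  by move: z1 z2; rewrite /dvdn => /eqP -> /eqP ->.
by rewrite !modn_small // => /eqP.
Qed.

(* A word without fixed point moves [d] to some [e1 < d]; if the two
   trajectories from [e1] and [d] merged, [e1] would be fixed. *)
Lemma no_fixpointP d w : 0 < d ->
  (forall q, q <= d -> foldr (step d) q w != q) <->
  (d %| size w /\ exists2 e, e < d & aligned d e w && odd (count negb w)).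
Proof.
move=> d_gt0; split=> [noF | [dvd_w [e lt_ed /andP[al odd_w]]] q].
  set e := foldr (step d) d w.
  have lt_ed : e < d by rewrite ltn_neqAle noF //= foldr_step_le.
  have := foldr_step_pair w lt_ed; have /eqP := noF e (ltnW lt_ed).
  case: ifP => [al | _] NE /=; last by [].
  case: ifP => [odd_w | _] [E1 E2]; last by rewrite -/e in E2; lia.
  split; last by exists e; rewrite ?al.
  have : 0 + e = size w + e %[mod d].
    by rewrite add0n [size w + _]addnC -E2 -/e modn_small.
  by move/eqP; rewrite eqn_modDr mod0n eq_sym.
have := foldr_step_pair w lt_ed; rewrite al odd_w /=.
have -> : (e + size w) %% d = e by rewrite -modnDmr (eqP dvd_w) addn0 modn_small.
move=> [Ge Gd]; rewrite leq_eqVlt => /orP[/eqP -> | lt_qd].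
  by rewrite Gd; lia.
(* An aligned [q] equals [e], which goes to [d]; any other [q] merges with [d] and ends at [e],
   which is aligned and so differs from [q]. *)
have := foldr_step_pair w lt_qd; case: ifP => [al' _ | al' ->].
  by rewrite -(aligned_inj lt_ed lt_qd odd_w al al') Ge; lia.
by rewrite Gd; apply/eqP => eq_eq; rewrite -eq_eq al in al'.
Qed.

(** * Capped runs of ones and periodic preimages *)

(** Below the cap the minimum is invisible: a run is [r.+1] iff [X i] holds and the next run is [r].
    Hence the recursion alone locates all values less than [d]. *)
Lemma capped_run_eq (d : nat) (X : pred nat) (Q : nat -> nat) :
  (forall i, Q i = if X i then minn (Q i.+1).+1 d else 0) ->
  forall r i, r < d -> (Q i == r) = all X (iota i r) && ~~ X (i + r).
Proof.
move=> QE; elim=> [|r IHr] i lt_rd; rewrite QE /= ?addn0.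
  by case: (X i) => //=; lia.
by case: (X i) => //=; rewrite addnS -addSn -IHr ?(ltnW lt_rd) //; lia.
Qed.

Lemma capped_run_rec (d : nat) (X : pred nat) (i : nat) : 0 < d ->
  let Q j := find (predC X) (iota j d) in
  Q i = if X i then minn (Q i.+1).+1 d else 0.
Proof.
case: d => // d _ Q.
have -> : Q i = if X i then (find (predC X) (iota i.+1 d)).+1 else 0.
  by rewrite /Q /=; case: (X i).
(* With cap [d.+1], the window at [i.+1] has one extra last place; it can only raise the run from
   [d] to [d.+1], which the cap hides in [Q i]. *)
have -> : Q i.+1 = find (predC X) (iota i.+1 d ++ [:: i.+1 + d]).
  by rewrite /Q -[d.+1]addn1 iotaD.
rewrite find_cat; case: (X i) => //.
have := find_size (predC X) (iota i.+1 d).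
have := has_find (predC X) (iota i.+1 d); rewrite size_iota.
case: ifP => _ /=; first by lia.
by case: ifP; lia.
Qed.

Lemma foldr_orbit (d : nat) (Y : pred nat) (Q : nat -> nat) :
  (forall i, Q i = step d (Y i) (Q i.+1)) ->
  forall m i, foldr (step d) (Q (i + m)) (map Y (iota i m)) = Q i.
Proof.
move=> QE; elim=> [|m IHm] i /=; first by rewrite addn0.
by rewrite addnS -addSn IHm -QE.
Qed.

(** The capped runs of a preimage form an orbit that closes up by periodicity; conversely, the
    nonzero states of a closed orbit mark the ones of a preimage. *)
Lemma periodic_preimageP (d n : nat) (Y : pred nat) : 0 < d -> 0 < n ->
  (forall i, Y (i %% n) = Y i) ->
  (exists2 X : pred nat, forall i, X (i %% n) = X i &
     forall i, Y i = X i (+) (all X (iota i.+1 d.-1) && ~~ X (i + d))) <->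
  (exists2 q, q <= d & foldr (step d) q (map Y (iota 0 n)) = q).
Proof.
move=> d_gt0 n_gt0 Yper; split=> [[X Xper XY] | [q le_qd qfix]].
  pose Q j := find (predC X) (iota j d).
  have QE i : Q i = if X i then minn (Q i.+1).+1 d else 0.
    exact: capped_run_rec.
  (* The conjunction in [XY] is the test [Q i.+1 == d.-1], so adding it to [Y i] recovers [X i]. *)
  have stepQ i : Q i = step d (Y i) (Q i.+1).
    rewrite /step (capped_run_eq QE) ?prednK // XY addSnnS prednK //.
    by rewrite -addbA addbb addbF -QE.
  exists (Q n); first by rewrite -[d in _ <= d](size_iota n d) find_size.
  have := foldr_orbit stepQ n 0; rewrite add0n => ->.
  rewrite /Q -[n in RHS]addn0 (iotaDl n 0) find_map; apply: eq_find => j /=.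
  by rewrite -Xper -[in RHS]Xper modnDl.
(* The state after reading from [n - 1] down to [i %% n]; where the index wraps to 0, [qfix] closes
   the orbit. *)
pose Q i := foldr (step d) q (map Y (iota (i %% n) (n - i %% n))).
have stepQ i : Q i = step d (Y i) (Q i.+1).
  rewrite /Q; have lt_in := ltn_pmod i n_gt0.
  rewrite -[n - i %% n]prednK ?subn_gt0 //= Yper; congr step.
  rewrite -[in i.+1 %% n]addn1 -modnDml addn1.
  move: lt_in; rewrite leq_eqVlt => /orP[/eqP E | lt_in].
    have -> : (n - i %% n).-1 = 0 by lia.
    by rewrite E modnn subn0 qfix.
  by rewrite (modn_small lt_in) subnS.
have QE i : Q i = if Q i != 0 then minn (Q i.+1).+1 d else 0.
  by rewrite stepQ /step; case: (_ (+) _) => //=; case: eqP.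
exists (fun i => Q i != 0) => i; first by rewrite /Q modn_mod.
have := capped_run_eq QE (r := d.-1) i.+1.
rewrite prednK // leqnn addSnnS prednK // => <- //.
have -> : (Q i != 0) = Y i (+) (Q i.+1 == d.-1).
  rewrite stepQ /step; case: (_ (+) _) => //.
  by rewrite -lt0n leq_min d_gt0.
by rewrite addbK.
Qed.

(** * From rows over ['F_2] to boolean words *)

Lemma F2E (a : 'F_2) : a = (a != 0%R)%:R%R.
Proof. by case: a => -[|[|m]] ?; apply/val_inj. Qed.

Lemma F2_inj (a b : 'F_2) : (a != 0%R) = (b != 0%R) -> a = b.
Proof. by move=> ab; rewrite [a]F2E ab -F2E. Qed.

Lemma F2D_neq0 (a b : 'F_2) : ((a + b)%R != 0%R) = (a != 0%R) (+) (b != 0%R).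
Proof. by rewrite [a]F2E [b]F2E; case: (a != 0%R); case: (b != 0%R). Qed.

Lemma all_iota_ord (d : nat) (X : pred nat) (i : nat) :
  all X (iota i.+1 d.-1) = [forall j : 'I_d.+1, (0 < j < d) ==> X (i + j)].
Proof.
apply/allP/forallP => [allX j | allX k].
  by apply/implyP => j_in; apply: allX; rewrite mem_iota; lia.
rewrite mem_iota => k_in; have lt_kd : k - i < d.+1 by lia.
have /implyP := allX (Ordinal lt_kd); rewrite /= subnKC; last by lia.
by apply; lia.
Qed.

Lemma rule_neq0 (d : nat) (x : 'rV['F_2]_d.+1) (X : pred nat) (i : nat) :
  (forall j, (x ord0 j != 0%R) = X (i + j)) ->
  (rule x != 0%R) = X i (+) (all X (iota i.+1 d.-1) && ~~ X (i + d)).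
Proof.
move=> xX; rewrite /rule F2D_neq0 xX addn0; congr (_ (+) _).
rewrite mulf_eq0 negb_or F2D_neq0 xX oner_neq0 addbT; congr (_ && _).
rewrite all_iota_ord; apply/prodf_neq0/forallP => H j; first apply/implyP.
  by move/H; rewrite xX.
by move=> j_in; rewrite xX; apply: (implyP (H j)).
Qed.

Definition word (n : nat) (y : 'rV['F_2]_n) : seq bool :=
  [seq y ord0 i != 0%R | i <- enum 'I_n].

Lemma size_word n (y : 'rV['F_2]_n) : size (word y) = n.
Proof. by rewrite size_map size_enum_ord. Qed.

Lemma codom_induced_mapP (d n : nat) (y : 'rV['F_2]_n) : 0 < d -> 0 < n ->
  y \in codom (@induced_map d.+1 (@rule d) n) <->
  (exists2 q, q <= d & foldr (step d) q (word y) = q).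
Proof.
move=> d_gt0 n_gt0; pose pos i : 'I_n := Ordinal (ltn_pmod i n_gt0).
(* The [n]-periodic extension of a row turns cyclic indices into plain sums. *)
pose per (z : 'rV['F_2]_n) i := z ord0 (pos i) != 0%R.
have perP z i : per z (i %% n) = per z i.
  by rewrite /per; congr (z _ _ != _); apply: val_inj; rewrite /= modn_mod.
have per_ord z (i : 'I_n) : per z i = (z ord0 i != 0%R).
  by rewrite /per; congr (z _ _ != _); apply: val_inj; rewrite /= modn_small.
have -> : word y = map (per y) (iota 0 n).
  rewrite -val_enum_ord -map_comp; apply: eq_map => i /=; exact/esym/per_ord.
have im_per x i : per (induced_map (@rule d) x) i =
    per x i (+) (all (per x) (iota i.+1 d.-1) && ~~ per x (i + d)).
  rewrite /per mxE; apply: rule_neq0 => j; rewrite mxE.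
  by congr (x _ _ != _); apply: val_inj; rewrite /= modnDml.
apply: iff_trans (periodic_preimageP d_gt0 n_gt0 (perP y)).
split=> [/codomP[x ->] | [X Xper XY]].
  exists (per x); [exact: perP | exact: im_per].
pose x : 'rV['F_2]_n := (\row_i (X i)%:R)%R.
have xX : per x =1 X by move=> i; rewrite /per mxE /= Xper; case: (X i).
apply/codomP; exists x; apply/rowP => i; apply: F2_inj.
by rewrite -!per_ord im_per XY !xX (eq_all xX).
Qed.

(** * Zero sets and residue classes *)

Lemma alignedE d e w : aligned d e w =
  all (fun i => nth true w i || (d %| e + (size w - i))) (iota 0 (size w)).
Proof.
elim: w => //= b v ->; rewrite subn0 andbC -[1]addn0 iotaDl all_map.
by congr (_ && _); apply: eq_all.
Qed.

Definition residue_class (d n e : nat) : {set 'I_n} := [set i : 'I_n | i %% d == e].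

(** Since [d] divides [n], the test [d %| e + (n - i)] made at a zero says that [i] is congruent to
    [e]. *)
Lemma aligned_word d n e (y : 'rV['F_2]_n) : d %| n -> e < d ->
  aligned d e (word y) = ([set i | y ord0 i == 0%R] \subset residue_class d n e).
Proof.
move=> dvd_n lt_ed; rewrite alignedE size_word -val_enum_ord all_map.
have entry (i : 'I_n) : nth true (word y) i = (y ord0 i != 0%R).
  by rewrite (nth_map i) ?size_enum_ord // nth_ord_enum.
have class (i : 'I_n) : (d %| e + (n - i)) = (i \in residue_class d n e).
  have le_in := ltnW (ltn_ord i).
  rewrite inE addnBA // -eqn_mod_dvd ?(leq_trans le_in) ?leq_addl //.
  by rewrite -modnDmr (eqP dvd_n) addn0 modn_small // eq_sym.
apply/allP/subsetP => H i.
  by rewrite inE => yi0; have /= := H i (mem_enum _ i); rewrite entry class yi0.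
by move=> _ /=; rewrite entry class; case: eqP => //= yi0; apply: H; rewrite inE yi0.
Qed.

Lemma count_word n (y : 'rV['F_2]_n) :
  count negb (word y) = #|[set i | y ord0 i == 0%R]|.
Proof.
rewrite count_map -sum1_count big_enum_cond -sum1_card; apply: eq_bigl => i.
by rewrite !inE /= negbK.
Qed.

(** * Counting the words outside the image *)

(** Deleting a fixed [a] of [C] maps the odd subsets bijectively onto all subsets of [C :\ a]:
    parity decides whether [a] was present. *)
Lemma card_odd_subsets (T : finType) (C : {set T}) : 0 < #|C| ->
  #|[set Z : {set T} | (Z \subset C) && odd #|Z|]| = 2 ^ (#|C| - 1).
Proof.
case/card_gt0P => a aC.
rewrite (cardsD1 a C) aC addKn -card_powerset.
pose h (Z : {set T}) := Z :\ a.
rewrite -(card_in_imset (f := h)); last first.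
  move=> Z1 Z2; rewrite !inE => /andP[_ o1] /andP[_ o2] eqh.
  move: o1 o2; rewrite (cardsD1 a Z1) (cardsD1 a Z2) -/(h Z1) -/(h Z2) eqh !oddD.
  rewrite !oddb => o1 o2; have eqa : (a \in Z1) = (a \in Z2).
    by case: (a \in Z1) o1; case: (a \in Z2) o2; case: (odd _).
  apply/setP => x; case: (eqVneq x a) => [-> // | ne_xa].
  by move/setP/(_ x): eqh; rewrite !inE ne_xa.
apply: eq_card => B; rewrite powersetE; apply/imsetP/idP => [[Z] | sBC].
  by rewrite inE => /andP[sZC _] ->; apply: setSD.
have aB : a \notin B.
  by apply: contraTN sBC => aB; apply/subsetPn; exists a; rewrite ?inE ?eqxx.
have sB : B \subset C by apply: subset_trans sBC (subsetDl _ _).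
exists (if odd #|B| then B else a |: B).
  case: ifP => oB; rewrite inE ?sB ?oB // cardsU1 aB /= oB andbT.
  by rewrite subUset sub1set aC.
by case: ifP => _; apply/setP => x; rewrite !inE; case: eqVneq => //= ->; apply/negbTE.
Qed.

Lemma card_residue_class d n e : d %| n -> e < d -> #|residue_class d n e| = n %/ d.
Proof.
move=> /dvdnP[m ->] lt_ed; have d_gt0 : 0 < d by lia.
rewrite mulnK // -[RHS]card_ord.
have lt_ord (k : 'I_m) : k * d + e < m * d by have := ltn_ord k; nia.
pose h k : 'I_(m * d) := Ordinal (lt_ord k).
have h_inj : injective h.
  by move=> k1 k2 /(congr1 val) /= /addIn /eqP; rewrite eqn_pmul2r // => /eqP /val_inj.
rewrite -cardsT -(card_imset _ h_inj); apply: eq_card => i; rewrite inE.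
apply/eqP/imsetP => [ie | [k _ ->]]; last by rewrite /= modnMDl modn_small.
have lt_im : i %/ d < m by rewrite ltn_divLR.
by exists (Ordinal lt_im) => //; apply: val_inj; rewrite /= -ie -divn_eq.
Qed.

Lemma not_in_codomP (d n : nat) (y : 'rV['F_2]_n) : 0 < d -> 0 < n ->
  let Z := [set i | y ord0 i == 0%R] in
  (y \notin codom (@induced_map d.+1 (@rule d) n)) =
  (d %| n) && [exists e : 'I_d, (Z \subset residue_class d n e) && odd #|Z|].
Proof.
move=> d_gt0 n_gt0 Z; have codomP := codom_induced_mapP y d_gt0 n_gt0.
have noFP := no_fixpointP (word y) d_gt0.
rewrite size_word count_word -/Z in noFP.
apply/idP/andP => [notin | [dvd_n /existsP[e H]]].
  have [|dvd_n [e lt_ed al]] := noFP.1.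
    move=> q le_qd; apply: contraNneq notin => qfix; apply/codomP.
    by exists q.
  split=> //; apply/existsP; exists (Ordinal lt_ed).
  by rewrite -aligned_word.
apply/negP => /codomP[q le_qd /eqP]; apply/negP; apply: noFP.2 => //.
by split=> //; exists e; rewrite ?aligned_word.
Qed.

Lemma card_not_in_codom (d n : nat) : 0 < d -> 0 < n ->
  num_not_in_image (@rule d) n = if d %| n then d * 2 ^ (n %/ d - 1) else 0.
Proof.
move=> d_gt0 n_gt0; rewrite /num_not_in_image.
pose zeros (y : 'rV['F_2]_n) := [set i | y ord0 i == 0%R].
rewrite (eq_card (B := [set y | (d %| n) && [exists e : 'I_d,
  (zeros y \subset residue_class d n e) && odd #|zeros y|]])); last first.
  by move=> y; rewrite inE not_in_codomP // !inE.
case: ifP => dvd_n /=; last by apply: eq_card0 => y; rewrite inE.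
pose row_of (Z : {set 'I_n}) : 'rV['F_2]_n := (\row_i (i \notin Z)%:R)%R.
have zerosK : cancel zeros row_of.
  by move=> y; apply/rowP => i; rewrite mxE inE [RHS]F2E.
have row_ofK : cancel row_of zeros.
  by move=> Z; apply/setP => i; rewrite inE mxE; case: (i \in Z).
rewrite -(card_imset _ (can_inj zerosK)).
pose P (Z : {set 'I_n}) (e : 'I_d) := (Z \subset residue_class d n e) && odd #|Z|.
(* An odd [Z] is nonempty, so it lies in at most one class, and the existence of [e] can be replaced
   by the number of such [e]; the two sums are then exchanged. *)
have -> : #|zeros @: [set y | [exists e, P (zeros y) e]]| = \sum_Z \sum_(e | P Z e) 1.
  rewrite -sum1_card big_mkcond; apply: eq_bigr => Z _.
  have -> : (Z \in zeros @: [set y | [exists e, P (zeros y) e]]) = [exists e, P Z e].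
    apply/imsetP/idP => [[y] | PZ]; first by rewrite inE => Py ->.
    by exists (row_of Z); rewrite ?inE row_ofK.
  case: existsP => [[e PZe] | noP]; last first.
    by rewrite big_pred0 // => e; apply/negP => PZe; apply: noP; exists e.
  rewrite (big_pred1 e) // => e'; apply/idP/eqP => [PZe' | -> //].
  case/andP: PZe PZe' => sZe oZ /andP[sZe' _].
  have [i iZ] : exists i, i \in Z by apply/set0Pn; rewrite -card_gt0 odd_gt0.
  have := subsetP sZe i iZ; have := subsetP sZe' i iZ.
  by rewrite !inE => /eqP ie' /eqP ie; apply: val_inj; rewrite /= -ie -ie'.
rewrite (exchange_big_dep xpredT) //=.
transitivity (\sum_(e < d) 2 ^ (n %/ d - 1)); last by rewrite sum_nat_const card_ord.
apply: eq_bigr => e _; have ce := card_residue_class dvd_n (ltn_ord e).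
have C_gt0 : 0 < #|residue_class d n e| by rewrite ce divn_gt0 // dvdn_leq.
rewrite -ce -(card_odd_subsets C_gt0) -sum1_card.
by apply: eq_bigl => Z; rewrite inE.
Qed.

(** * The algebraic degree of the rule *)

(** Expanding the last factor gives three monomials, with index sets [A], [B], [C]; for [d = 1] the
    set [C] is empty and its monomial is 1. The degree is the size of [B]. *)
Lemma rule_degree (d : nat) : 0 < d -> has_algebraic_degree (@rule d) d.
Proof.
move=> d_gt0; pose A := [set (@ord0 d)].
pose B := [set i : 'I_d.+1 | 0 < i]; pose C := B :\ ord_max.
have BM : ord_max \in B by rewrite inE.
exists (fun S => (S == A)%:R + ((S == B)%:R + (S == C)%:R))%R; split=> [x|].
  have monomial (T : {set 'I_d.+1}) :
    (\sum_(S : {set 'I_d.+1}) (S == T)%:R * \prod_(i in S) x ord0 i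
      = \prod_(i in T) x ord0 i)%R.
    rewrite (bigD1 T) //= eqxx mul1r [X in (_ + X)%R]big1 ?addr0 //.
    by move=> S /negbTE ->; rewrite mul0r.
  under eq_bigr do rewrite !mulrDl.
  rewrite !big_split /= !monomial /rule big_set1; congr (_ + _)%R.
  rewrite (big_setD1 _ BM) /= -/C mulrDr mulr1 mulrC.
  have -> // : (\prod_(i < d.+1 | (0 < i < d)%N) x ord0 i = \prod_(i in C) x ord0 i)%R.
  apply: eq_bigl => i; rewrite !inE -val_eqE /=; have := ltn_ord i; lia.
have cardB : #|B| = d.
  apply: etrans (_ : #|[set~ @ord0 d]| = d); last by rewrite cardsC1 card_ord.
  by apply: eq_card => i; rewrite !inE -val_eqE lt0n.
(* As [B] differs from [A] and [C], its coefficient does not cancel in characteristic 2. *)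
have neBC : B != C by apply: contraTneq BM => ->; rewrite !inE eqxx.
have neBA : B != A by apply: contraTneq BM => ->; rewrite !inE -val_eqE /=; lia.
apply/eqP; rewrite eqn_leq; apply/andP; split.
  apply: leq_trans (_ : #|B| <= _); first by rewrite cardB.
  apply: (leq_bigmax_cond (F := fun S : {set 'I_d.+1} => #|S|)).
  by rewrite eqxx (negbTE neBA) (negbTE neBC).
apply/bigmax_leqP => S.
case: (eqVneq S A) => [-> _|_]; first by rewrite cards1.
case: (eqVneq S B) => [-> _|_]; first by rewrite cardB.
case: (eqVneq S C) => [-> _|_]; last by rewrite !addr0 eqxx.
by apply: leq_trans (subset_leq_card (subsetDl B _)) _; rewrite cardB.
Qed.

Theorem proposition5p1 (d : nat) (d_gt0 : 0 < d) :
  has_algebraic_degree (@rule d) d /\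
  forall n : nat, d < n ->
    num_not_in_image (@rule d) n =
      if d %| n then d * 2 ^ (n %/ d - 1) else 0.
Proof.
split; first exact: rule_degree.
by move=> n lt_dn; apply: card_not_in_codom => //; lia.
Qed.
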